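(* Let $\mathbb{K}=\mathbb{R}$ or $\mathbb{C}$, and let $A=\begin{pmatrix}a&1\\0&a\end{pmatrix}$, $B=\begin{pmatrix}b&1\\0&b\end{pmatrix}$ with $a,b\in\mathbb{K}$. For any non-trivial solution $X\in M_2(\mathbb{K})$ of the system $XAX=BXB$, $XBX=AXA$ the following holds. (i) If $a,b\neq0$ and $a=b$, then $X$ has one of the forms $\begin{pmatrix}a&1\\0&a\end{pmatrix}$, $\begin{pmatrix}a+a\sqrt{\alpha}&\alpha\\-a^2&a-a\sqrt{\alpha}\end{pmatrix}$ or $\begin{pmatrix}a-a\sqrt{\alpha}&\alpha\\-a^2&a+a\sqrt{\alpha}\end{pmatrix}$, where $\alpha\in\mathbb{K}$. (ii) If $a,b\neq0$ and $a\neq b$, then $X$ has the form $\begin{pmatrix}\alpha&\frac{b^2+\alpha^2-\alpha(a+b)}{ab}\\-ab&(a+b)-\alpha\end{pmatrix}$ for some $\alpha\in\mathbb{K}$. (iii) If exactly one of $a,b$ is zero, then the system has only the trivial solution.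
   Context: The trivial solution is $X=0$; a non-trivial solution is a nonzero one. Here $\sqrt{\alpha}$ denotes a square root of $\alpha$. *)

(* Defs.v *)
From HB Require Import structures.
From mathcomp Require Import all_boot all_order all_algebra.
From mathcomp Require Import complex.
From mathcomp Require Import reals.

Set Implicit Arguments.
Unset Strict Implicit.
Unset Printing Implicit Defensive.

Import GRing.Theory.
Local Open Scope ring_scope.

(* Entries are listed row by row. *)
Definition mx2 (K : fieldType) (p q r s : K) : 'M[K]_2 :=
  \matrix_(i < 2, j < 2)
    if i == 0 then (if j == 0 then p else q) else (if j == 0 then r else s).

Definition jordan2 (K : fieldType) (a : K) : 'M[K]_2 := mx2 a 1 0 a.

Definition is_solution (K : fieldType) (A B X : 'M[K]_2) : Prop :=
  X *m A *m X = B *m X *m B /\ X *m B *m X = A *m X *m A.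

(* Main.v *)
(* Write t and d for the trace and determinant of X, and r for its lower left
   entry. If r <> 0, the equation X A X = B X B reads, entrywise, a t + r = b^2,
   a d = - b r and d = b t + r; together with the same equations with a and b
   exchanged, this gives the families of (i) and (ii), the latter only for
   a + b = 0. If r = 0, X is upper triangular with diagonal entries in
   {0, b^2 / a}, and the upper right entry leaves only X = 0, or X = A when a = b:
   the two equations determine that entry twice, and comparing the two values
   gives (a - b)^2 = 0. *)
Require Import Defs.
From HB Require Import structures.
From mathcomp Require Import all_boot all_order all_algebra.
From mathcomp Require Import complex.
From mathcomp Require Import reals.
From mathcomp Require Import ring.

Set Implicit Arguments.
Unset Strict Implicit.
Unset Printing Implicit Defensive.

Import GRing.Theory.
Local Open Scope ring_scope.

Lemma mx2_eta (K : fieldType) (X : 'M[K]_2) :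
  X = mx2 (X 0 0) (X 0 1) (X 1 0) (X 1 1).
Proof.
apply/matrixP => i j; rewrite mxE.
by case: i => [[|[|//]] hi]; case: j => [[|[|//]] hj]; congr (X _ _);
  apply: val_inj.
Qed.

Lemma mx2_inj (K : fieldType) (p q r s p' q' r' s' : K) :
  mx2 p q r s = mx2 p' q' r' s' -> [/\ p = p', q = q', r = r' & s = s'].
Proof.
move/matrixP => e.
by split; [move: (e 0 0) | move: (e 0 1) | move: (e 1 0) | move: (e 1 1)];
  rewrite !mxE.
Qed.

Lemma mul_mx2 (K : fieldType) (p q r s p' q' r' s' : K) :
  mx2 p q r s *m mx2 p' q' r' s' =
  mx2 (p * p' + q * r') (p * q' + q * s') (r * p' + s * r') (r * q' + s * s').
Proof.
rewrite [LHS]mx2_eta; congr mx2;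
  by rewrite mxE big_ord_recl big_ord1 !mxE.
Qed.

Lemma mx2_0 (K : fieldType) : mx2 0 0 0 0 = 0 :> 'M[K]_2.
Proof. by apply/matrixP => i j; rewrite !mxE; do 2!case: ifP. Qed.

Section HalfSystem.

Variables (K : fieldType) (a b p q r s : K).

(** The second equation of the system is this one with [a] and [b] exchanged, so the lemmas of this
    section serve for both. *)
Hypothesis eqX :
  mx2 p q r s *m jordan2 a *m mx2 p q r s =
  jordan2 b *m mx2 p q r s *m jordan2 b.

Lemma jordan2_entries :
  [/\ a * (p ^+ 2 + q * r) + p * r = b ^+ 2 * p + b * r,
      a * q * (p + s) + p * s = b ^+ 2 * q + b * (p + s) + r,
      r * (a * (p + s) + r) = r * b ^+ 2
    & a * (s ^+ 2 + q * r) + r * s = b ^+ 2 * s + b * r].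
Proof.
move: eqX; rewrite /jordan2 !mul_mx2 => /mx2_inj[e1 e2 e3 e4].
split; apply/eqP; rewrite -subr_eq0.
- by move/eqP: e1; rewrite -subr_eq0 => /eqP <-; apply/eqP; ring.
- by move/eqP: e2; rewrite -subr_eq0 => /eqP <-; apply/eqP; ring.
- by move/eqP: e3; rewrite -subr_eq0 => /eqP <-; apply/eqP; ring.
- by move/eqP: e4; rewrite -subr_eq0 => /eqP <-; apply/eqP; ring.
Qed.

(** Cancelling [r] in the lower left entry gives b^2 = a t + r. With this value of b^2, the identity
    p^2 + q r = p t - d reduces the upper row to relations in t, d and r. *)
Lemma jordan2_lower_neq0 : r != 0 ->
  [/\ r = b ^+ 2 - a * (p + s),
      a * (p * s - q * r) = - (b * r)
    & p * s - q * r = b * (p + s) + r].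
Proof.
move=> r0; have [e1 e2 /(mulfI r0) e3 _] := jordan2_entries.
have er : r = b ^+ 2 - a * (p + s) by rewrite -e3; ring.
split=> //.
- have -> : a * (p * s - q * r) =
    p * (a * (p + s) + r) - (a * (p ^+ 2 + q * r) + p * r) by ring.
  by rewrite e3 e1; ring.
- have -> : p * s - q * r =
    a * q * (p + s) + p * s - q * (a * (p + s) + r) by ring.
  by rewrite e3 e2; ring.
Qed.

Lemma jordan2_lower_eq0 : r = 0 ->
  [/\ p * (a * p) = p * b ^+ 2, s * (a * s) = s * b ^+ 2
    & a * q * (p + s) + p * s = b ^+ 2 * q + b * (p + s)].
Proof.
move=> r0; have [e1 e2 _ e4] := jordan2_entries; move: e1 e2 e4.
rewrite r0 !mulr0 mul0r !addr0 => e1 e2 e4; split=> //.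
- by rewrite -[RHS]mulrC -e1; ring.
- by rewrite -[RHS]mulrC -e4; ring.
Qed.

Lemma jordan2_triangular : b != 0 -> r = 0 ->
  mx2 p q r s = 0 \/
  [/\ a * p = b ^+ 2, s = p & b ^+ 2 * q = p * (2%:R * b - p)].
Proof.
move=> b0 r0; have [ep es eq] := jordan2_lower_eq0 r0.
have b20 : b ^+ 2 != 0 by rewrite expf_neq0.
case: (eqVneq p 0) => [p0|p0]; case: (eqVneq s 0) => [s0|s0].
- left; move/eqP: eq; rewrite p0 s0 r0 !(mulr0, addr0) eq_sym.
  by rewrite mulf_eq0 (negbTE b20) => /eqP ->; rewrite mx2_0.
(* With a single nonzero diagonal entry u, a u = b^2 cancels the [q] terms of the upper right
   equation, leaving b u = 0. *)
- move/(mulfI s0): es => es; move/eqP: eq.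
  rewrite p0 add0r mul0r addr0 mulrAC es -subr_eq0 opprD addrA subrr sub0r.
  by rewrite oppr_eq0 mulf_eq0 (negbTE b0) (negbTE s0).
- move/(mulfI p0): ep => ep; move/eqP: eq.
  rewrite s0 addr0 mulr0 addr0 mulrAC ep -subr_eq0 opprD addrA subrr sub0r.
  by rewrite oppr_eq0 mulf_eq0 (negbTE b0) (negbTE p0).
right; move/(mulfI p0): ep => ep; move/(mulfI s0): es => es.
have a0 : a != 0 by apply: contraNneq b20 => a0; rewrite -ep a0 mul0r.
have sp : s = p by apply: (mulfI a0); rewrite es ep.
split=> //; move: eq; rewrite sp => eq.
(* As a p = b^2, the net coefficient of [q] in [eq] is 2 a p - b^2 = b^2; the doubling exposes
   this. *)
have -> : b ^+ 2 * q = 2%:R * q * b ^+ 2 - b ^+ 2 * q by ring.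
rewrite -{1}ep.
have -> : 2%:R * q * (a * p) = a * q * (p + p) + p * p - p * p by ring.
by rewrite eq; ring.
Qed.

End HalfSystem.

Lemma is_solutionC (K : fieldType) (A B X : 'M[K]_2) :
  is_solution A B X -> is_solution B A X.
Proof. by case. Qed.

(** For a = 0, the relation a p = b^2 rules out a nonzero triangular X, and a d = - b r rules out r
    <> 0. *)
Lemma is_solution_jordan2_0 (K : fieldType) (b : K) (X : 'M[K]_2) :
  b != 0 -> is_solution (jordan2 0) (jordan2 b) X -> X = 0.
Proof.
move=> b0; rewrite (mx2_eta X).
set p := X 0 0; set q := X 0 1; set r := X 1 0; set s := X 1 1.
case=> e1 _; case: (eqVneq r 0) => [r0|r0].
- case: (jordan2_triangular e1 b0 r0) => // -[/eqP].
  by rewrite mul0r eq_sym expf_eq0 (negbTE b0).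
- have [_ /eqP] := jordan2_lower_neq0 e1 r0.
  by rewrite mul0r eq_sym oppr_eq0 mulf_eq0 (negbTE b0) (negbTE r0).
Qed.

(** When r <> 0, d = - r and d = a t + r = a^2 force r = - a^2 and t = 2 a, so only p stays free. *)
Lemma is_solution_jordan2_eq (K : fieldType) (a : K) (X : 'M[K]_2) :
  a != 0 -> is_solution (jordan2 a) (jordan2 a) X -> X != 0 ->
  X = mx2 a 1 0 a \/
  exists s, X = mx2 (a + a * s) (s ^+ 2) (- a ^+ 2) (a - a * s).
Proof.
move=> a0; have a20 : a ^+ 2 != 0 by rewrite expf_neq0.
rewrite (mx2_eta X).
set p := X 0 0; set q := X 0 1; set r := X 1 0; set s := X 1 1.
case=> e1 _ X0; case: (eqVneq r 0) => [r0|r0]; [left | right].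
- case: (jordan2_triangular e1 a0 r0) => [/eqP|[]]; first by rewrite (negbTE X0).
  rewrite expr2 => /(mulfI a0) -> -> eq.
  have -> : q = 1 by apply: (mulfI a20); rewrite expr2 eq; ring.
  by rewrite r0.
- have [er ed1 ed2] := jordan2_lower_neq0 e1 r0.
  have d : p * s - q * r = - r by apply: (mulfI a0); rewrite ed1; ring.
  have rE : r = - a ^+ 2.
    have : p * s - q * r = a ^+ 2 by rewrite ed2 {1}er; ring.
    by rewrite d => <-; rewrite opprK.
  have sE : s = 2%:R * a - p.
    apply: (mulfI a0); have -> : a * s = a ^+ 2 - r - a * p by rewrite er; ring.
    by rewrite rE; ring.
  have qE : a ^+ 2 * q = (p - a) ^+ 2.
    have -> : a ^+ 2 * q = (p * s - q * r) - p * s by rewrite rE; ring.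
    by rewrite d rE sE; ring.
  (* The root is solved from p = a + a s; [qE] says that the upper right entry is its square. *)
  exists ((p - a) / a); rewrite rE; congr mx2.
  + by field.
  + by apply: (mulfI a20); rewrite qE; field.
  + by rewrite sE; field.
Qed.

(** When r <> 0, subtracting b t + r = a^2 from a t + r = b^2 and dividing by a - b gives t = - (a +
    b); the determinant relations then force a + b = 0. *)
Lemma is_solution_jordan2_neq (K : fieldType) (a b : K) (X : 'M[K]_2) :
  a != 0 -> b != 0 -> a != b ->
  is_solution (jordan2 a) (jordan2 b) X -> X != 0 ->
  b = - a /\
  exists p, X = mx2 p (- (a ^+ 2 + p ^+ 2) / a ^+ 2) (a ^+ 2) (- p).
Proof.
move=> a0 b0 ab; have a20 : a ^+ 2 != 0 by rewrite expf_neq0.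
have ab0 : a - b != 0 by rewrite subr_eq0.
rewrite (mx2_eta X).
set p := X 0 0; set q := X 0 1; set r := X 1 0; set s := X 1 1.
case=> e1 e2 X0; case: (eqVneq r 0) => [r0|r0].
- case: (jordan2_triangular e1 b0 r0) => [/eqP|[pE _ qE]].
    by rewrite (negbTE X0).
  case: (jordan2_triangular e2 a0 r0) => [/eqP|[pE' _ qE']].
    by rewrite (negbTE X0).
  have p0 : p != 0.
    by apply: contraNneq a20 => p0; rewrite -pE' p0 mulr0.
  (* Contradiction: eliminating [q] between [qE] and [qE'], with (a + b) p = a^2 + b^2, makes this
     product vanish. *)
  have : (a - b) ^+ 3 * p != 0 by rewrite mulf_neq0 ?expf_neq0.
  have -> : (a - b) ^+ 3 * p =
    (a - b) * p * (a ^+ 2 + b ^+ 2) - (a - b) * p * (2%:R * a * b) by ring.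
  rewrite -{1}pE -{1}pE'.
  have -> : (a - b) * p * (b * p + a * p) - (a - b) * p * (2%:R * a * b) =
    b ^+ 2 * (p * (2%:R * a - p)) - a ^+ 2 * (p * (2%:R * b - p)) by ring.
  by rewrite -qE -qE' mulrCA subrr eqxx.
- have [er ed1 ed2] := jordan2_lower_neq0 e1 r0.
  have [er' ed1' ed2'] := jordan2_lower_neq0 e2 r0.
  have t0 : p + s = - (a + b).
    apply: (mulfI ab0); transitivity (a * (p + s) + r - (b * (p + s) + r)).
      by ring.
    by rewrite {1}er {1}er'; ring.
  (* Computing a b d from [ed1] and from [ed1'] gives (a^2 - b^2) r = 0. *)
  have bE : b = - a.
    apply/eqP; rewrite -addr_eq0 -(mulrI_eq0 _ (mulfI ab0)).
    rewrite -(mulIr_eq0 _ (mulIf r0)).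
    have -> : (a - b) * (b + a) * r = b * - (b * r) - a * - (a * r) by ring.
    by rewrite -ed1 -ed1'; apply/eqP; ring.
  split=> //; exists p.
  have sE : s = - p by apply/eqP; rewrite -addr_eq0 addrC t0 bE subrr oppr0.
  have rE : r = a ^+ 2 by rewrite er' t0 bE; ring.
  rewrite rE sE; congr mx2; apply: (mulfI a20).
  have -> : a ^+ 2 * q = p * s - (p * s - q * r) by rewrite rE; ring.
  by rewrite ed2 t0 bE sE rE; field.
Qed.

Theorem proposition6p5 (R : realType) (K : fieldType)
  (hK : K = (R : fieldType) \/ K = (R[i] : fieldType)) (a b : K) :
  [/\ (* (i) *)
      a != 0 -> b != 0 -> a = b ->
      forall X : 'M[K]_2, is_solution (jordan2 a) (jordan2 b) X -> X != 0 ->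
        [\/ X = mx2 a 1 0 a,
            exists alpha s : K, s ^+ 2 = alpha /\
              X = mx2 (a + a * s) alpha (- a ^+ 2) (a - a * s)
          | exists alpha s : K, s ^+ 2 = alpha /\
              X = mx2 (a - a * s) alpha (- a ^+ 2) (a + a * s)],
      (* (ii) *)
      a != 0 -> b != 0 -> a != b ->
      forall X : 'M[K]_2, is_solution (jordan2 a) (jordan2 b) X -> X != 0 ->
        exists alpha : K,
          X = mx2 alpha
                  ((b ^+ 2 + alpha ^+ 2 - alpha * (a + b)) / (a * b))
                  (- (a * b))
                  (a + b - alpha)
    & (* (iii) *)
      (a = 0 /\ b != 0) \/ (a != 0 /\ b = 0) ->
      forall X : 'M[K]_2, is_solution (jordan2 a) (jordan2 b) X <-> X = 0].
Proof.
split=> [a0 _ <-{b} X sX X0|a0 b0 ab X sX X0|ab X].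
- case: (is_solution_jordan2_eq a0 sX X0) => [->|[s ->]]; first by constructor 1.
  (* The sign of the root [s] is free, so the second form also covers the third. *)
  by constructor 2; exists (s ^+ 2), s.
- have [bE [p ->]] := is_solution_jordan2_neq a0 b0 ab sX X0.
  (* At b = - a the family of (ii) with alpha = p is the trace-zero family just found. *)
  by exists p; rewrite bE; congr mx2; [field; rewrite oppr_eq0 a0 | ring | ring].
- split=> [sX|->]; last by split; rewrite !(mulmx0, mul0mx).
  case: ab => -[h1 h2].
  + by apply: (is_solution_jordan2_0 h2); rewrite -h1.
  + by apply: (is_solution_jordan2_0 h1); rewrite -h2; apply: is_solutionC.
Qed.
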